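(* Let $\Bbbk$ be a field and let $A$ be a finite-dimensional $\Bbbk$-algebra. Then the Kleisli convolution representations of $A$ and their homomorphisms form a $\Bbbk$-linear category $\mathsf{Klcrep}(A)$, and there is a $\Bbbk$-linear equivalence $$\mathsf{Klcrep}(A)\simeq\mathsf{rep}(A),$$ where $\mathsf{rep}(A)$ is the category of finite-dimensional representations of $A$ (finite-dimensional left $A$-modules).
   Context: $A$ is associative with identity $1_A$. Let $\mathbf 1=\{\bullet\}$, and for a finite set $X$ put $E_X=X\times X$. **Free $\Bbbk$-module monad.** For a set $X$, $\mathcal M_{\Bbbk}(X)$ is the set of finite formal sums $\sum_{x\in X}a_x[x]$, $a_x\in\Bbbk$. With $\mathcal M_{\Bbbk}(f)(\sum a_x[x])=\sum a_x[f(x)]$, unit $x\mapsto[x]$ and multiplication $\sum_\ell c_\ell[\sum_x a_{\ell,x}[x]]\mapsto\sum_x(\sum_\ell c_\ell a_{\ell,x})[x]$ this is a monad $\mathscr M_{\Bbbk}$ on $\mathsf{Set}$. A Kleisli arrow $f:X\rightsquigarrow Y$ is a map $f:X\to\mathcal M_{\Bbbk}(Y)$, $f(x)=\sum_y f_{y,x}[y]$; its matrix is $[f]=(f_{y,x})$, Kleisli composition satisfies $[h\circ_{\mathsf{Kl}}f]=[h][f]$, and the Kleisli identity has identity matrix. For finite $X$, $\mathbb H_{\Bbbk}(X)=\mathrm{Hom}_{\mathsf{Kl}(\mathscr M_{\Bbbk})}(\mathbf 1,E_X)$ is a unital $\Bbbk$-algebra with pointwise linear structure and multiplication the Kleisli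 convolution (the Kleisli composite of $\mathbf 1\cong\mathbf 1\times\mathbf 1$, the Kleisli tensor product $f\otimes g$, and $m_X$, where $m_X((i,j),(p,q))=[(i,q)]$ if $j=p$ and $0$ otherwise), with unit $u_X(\bullet)=\sum_{x\in X}[(x,x)]$. The map $\Phi_X:\mathbb H_{\Bbbk}(X)\to\mathrm{Mat}_X(\Bbbk)$, $\Phi_X(f)=(f_{i,j})_{i,j\in X}$ where $f(\bullet)=\sum f_{i,j}[(i,j)]$, is an isomorphism of $\Bbbk$-algebras onto the $X\times X$ matrices with ordinary multiplication. **Kleisli convolution representations of $A$.** Such a representation is a pair $(X,\theta)$ with $X$ a finite set and $\theta:A\to\mathbb H_{\Bbbk}(X)$ a unital $\Bbbk$-algebra homomorphism. A homomorphism $(X,\theta_X)\to(Y,\theta_Y)$ is a Kleisli arrow $f:X\rightsquigarrow Y$ in $\mathsf{Kl}(\mathscr M_{\Bbbk})$ such that $\Phi_Y(\theta_Y(a))[f]=[f]\Phi_X(\theta_X(a))$ for every $a\in A$. Composition is Kleisli composition; morphisms are added and scaled via their matrices. *)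

(* Defs.v *)
From HB Require Import structures.
From mathcomp Require Import all_boot all_order all_algebra all_field.
From mathcomp Require Import finmap.
From mathcomp.classical Require Import boolp functions.
From mathcomp.multinomials Require Import monalg.

Set Implicit Arguments.
Unset Strict Implicit.
Unset Printing Implicit Defensive.

Import GRing.Theory.
Local Open Scope ring_scope.

(* [falgType] imposes 1 != 0; here the zero algebra is allowed as well. *)
Record fdAlgebra (k : fieldType) := FdAlgebra {
  fdalg_sort :> vectType k;
  amul : fdalg_sort -> fdalg_sort -> fdalg_sort;
  aone : fdalg_sort;
  amulA : associative amul;
  amul1a : left_id aone amul;
  amula1 : right_id aone amul;
  amul_linearl : forall b, linear (amul^~ b);
  amul_linearr : forall a, linear (amul a) }.
Arguments aone {k A} : rename.

Section OfFalgType.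
Variables (k : fieldType) (A : falgType k).

Fact falg_mul_linearl (b : A) : linear ( *%R^~ b).
Proof. by move=> c u v; rewrite mulrDl scalerAl. Qed.

Fact falg_mul_linearr (a : A) : linear ( *%R a).
Proof. by move=> c u v; rewrite mulrDr scalerAr. Qed.

Definition fdAlgebra_of_falgType : fdAlgebra k :=
  FdAlgebra (@mulrA A) (@mul1r A) (@mulr1 A) falg_mul_linearl falg_mul_linearr.

End OfFalgType.

Record linCatData (k : fieldType) := LinCatData {
  cobj :> Type;
  chom : cobj -> cobj -> lmodType k;
  cid : forall x, chom x x;
  ccomp : forall x y z, chom y z -> chom x y -> chom x z }.
Arguments chom {k C} x y : rename.
Arguments cid {k C} x : rename.
Arguments ccomp {k C x y z} g f : rename.

Record isLinCat (k : fieldType) (C : linCatData k) : Prop := IsLinCat {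
  ccomp1f : forall (x y : C) (f : chom x y), ccomp (cid y) f = f;
  ccompf1 : forall (x y : C) (f : chom x y), ccomp f (cid x) = f;
  ccompA : forall (x y z t : C) (h : chom z t) (g : chom y z) (f : chom x y),
    ccomp h (ccomp g f) = ccomp (ccomp h g) f;
  ccomp_linearl : forall (x y z : C) (f : chom x y),
    linear (fun g : chom y z => ccomp g f);
  ccomp_linearr : forall (x y z : C) (g : chom y z),
    linear (fun f : chom x y => ccomp g f) }.

Record linCat (k : fieldType) := LinCat {
  lincat_data :> linCatData k;
  lincatP : isLinCat lincat_data }.

Record linFunctor (k : fieldType) (C D : linCat k) := LinFunctor {
  fobj :> C -> D;
  fmap : forall x y : C, {linear chom x y -> chom (fobj x) (fobj y)};
  fmap1 : forall x : C, fmap x x (cid x) = cid (fobj x);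
  fmapM : forall (x y z : C) (g : chom y z) (f : chom x y),
    fmap x z (ccomp g f) = ccomp (fmap y z g) (fmap x y f) }.
Arguments fmap {k C D} F {x y} : rename.

Section Functors.
Variable k : fieldType.

Definition idFunctor (C : linCat k) : linFunctor C C :=
  @LinFunctor k C C id (fun _ _ => idfun)
    (fun _ => erefl) (fun _ _ _ _ _ => erefl).

Section Comp.
Variables (C D E : linCat k) (G : linFunctor D E) (F : linFunctor C D).

Fact compFunctor1 (x : C) :
  (fmap G \o fmap F) (cid x) = cid (G (F x)).
Proof. by rewrite /= !fmap1. Qed.

Fact compFunctorM (x y z : C) (g : chom y z) (f : chom x y) :
  (fmap G \o fmap F) (ccomp g f) =
  ccomp ((fmap G \o fmap F) g) ((fmap G \o fmap F) f).
Proof. by rewrite /= !fmapM. Qed.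

Definition compFunctor : linFunctor C E :=
  @LinFunctor k C E (G \o F) (fun x y => fmap G \o @fmap k C D F x y)
    compFunctor1 compFunctorM.

End Comp.

Definition naturally_isomorphic (C D : linCat k) (F G : linFunctor C D) : Prop :=
  exists (eta : forall x : C, @chom k D (F x) (G x))
         (eta' : forall x : C, @chom k D (G x) (F x)),
  [/\ forall x, ccomp (eta' x) (eta x) = cid (F x),
      forall x, ccomp (eta x) (eta' x) = cid (G x) &
      forall (x y : C) (f : chom x y),
        ccomp (eta y) (fmap F f) = ccomp (fmap G f) (eta x)].

Definition linearly_equivalent (C D : linCat k) : Prop :=
  exists (F : linFunctor C D) (G : linFunctor D C),
    naturally_isomorphic (idFunctor C) (compFunctor G F) /\
    naturally_isomorphic (compFunctor F G) (idFunctor D).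

End Functors.

Section Kleisli.
Variable k : fieldType.

(* [{malg k[X]}] is the set of finite formal sums; [<< c *g x >>] is c[x].    *)
Definition freemod_map (X Y : choiceType) (f : X -> Y) (m : {malg k[X]}) :
    {malg k[Y]} :=
  \sum_(x <- msupp m) << m@_x *g f x >>.

Definition freemod_unit (X : choiceType) (x : X) : {malg k[X]} :=
  << (1 : k) *g x >>.

Definition freemod_mult (X : choiceType) (M : {malg k[{malg k[X]}]}) :
    {malg k[X]} :=
  \sum_(m <- msupp M) M@_m *: m.

Definition kleisli (X Y : choiceType) := X -> {malg k[Y]}.

Definition kpure (X Y : choiceType) (f : X -> Y) : kleisli X Y :=
  fun x => freemod_unit (f x).

Definition kid (X : choiceType) : kleisli X X := kpure id.

Definition kcomp (X Y Z : choiceType) (h : kleisli Y Z) (f : kleisli X Y) :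
    kleisli X Z :=
  fun x => freemod_mult (freemod_map h (f x)).

Definition ktensor (X X' Y Y' : choiceType)
    (f : kleisli X Y) (g : kleisli X' Y') : kleisli (X * X')%type (Y * Y')%type :=
  fun p => \sum_(y <- msupp (f p.1)) \sum_(y' <- msupp (g p.2))
    << (f p.1)@_y * (g p.2)@_y' *g (y, y') >>.

(* The matrix (f_{y,x}) of f; finite index sets are enumerated, since library *)
(* matrices are indexed by ordinals.                                          *)
Definition kmatrix (X Y : finType) (f : kleisli X Y) : 'M[k]_(#|Y|, #|X|) :=
  \matrix_(i, j) (f (enum_val j))@_(enum_val i).

Definition convAlg (X : finType) := kleisli unit (X * X)%type.

Definition conv_pairing (X : finType) :
    kleisli ((X * X) * (X * X))%type (X * X)%type :=
  fun p => if p.1.2 == p.2.1 then freemod_unit (p.1.1, p.2.2) else 0.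

Definition conv (X : finType) (f g : convAlg X) : convAlg X :=
  kcomp (@conv_pairing X)
    (kcomp (ktensor f g) (kpure (fun _ : unit => (tt, tt)))).

Definition conv_unit (X : finType) : convAlg X :=
  fun=> \sum_(x : X) freemod_unit (x, x).

Definition conv_matrix (X : finType) (f : convAlg X) : 'M[k]_#|X| :=
  \matrix_(i, j) (f tt)@_(enum_val i, enum_val j).

Lemma freemod_bindE (X Y : choiceType) (h : kleisli X Y) (m : {malg k[X]}) z :
  (freemod_mult (freemod_map h m))@_z = \sum_(x <- msupp m) m@_x * (h x)@_z.
Proof.
have multE (W : {fset {malg k[Y]}}) (M : {malg k[{malg k[Y]}]}) :
    (msupp M `<=` W)%fset ->
    freemod_mult M = \sum_(u <- W) M@_u *: u.
  move=> sMW; rewrite /freemod_mult (big_fset_incl _ sMW) //= => u _ uM.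
  by rewrite mcoeff_outdom // scale0r.
pose W : {fset {malg k[Y]}} := [fset h x | x in msupp m]%fset.
have sW : (msupp (freemod_map h m) `<=` W)%fset.
  apply/fsubsetP => u; rewrite -mcoeff_neq0 /freemod_map raddf_sum /=.
  apply: contraNT => uW; rewrite big_seq big1 // => x xm.
  rewrite mcoeffU; case: eqP => // hxu; case/negP: uW.
  by rewrite -hxu; apply: in_imfset.
rewrite (multE W) // raddf_sum /=.
under eq_bigr => u _ do rewrite /= mcoeffZ /freemod_map raddf_sum /= mulr_suml.
rewrite exchange_big /= big_seq [RHS]big_seq; apply: eq_bigr => x xm.
have hxW : h x \in W by apply: in_imfset.
rewrite (big_fsetD1 (h x)) //= mcoeffUU big1_fset ?addr0 // => u.
by rewrite in_fsetD1 mcoeffU => /andP[/negPf uh _] _; rewrite eq_sym uh mul0r.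
Qed.

Lemma kmatrix_comp (X Y Z : finType) (h : kleisli Y Z) (f : kleisli X Y) :
  kmatrix (kcomp h f) = kmatrix h *m kmatrix f.
Proof.
apply/matrixP => i j; rewrite !mxE /kcomp freemod_bindE.
set m := f _; rewrite big_uniq ?fset_uniq //= big_mkcond /=.
rewrite (reindex (enum_val (A := Y))) /=; last exact/onW_bij/enum_val_bij.
apply: eq_bigr => l _; rewrite !mxE mulrC.
by case: ifPn => // /mcoeff_outdom ->; rewrite mulr0.
Qed.

Lemma kmatrix_id (X : finType) : kmatrix (@kid X) = 1%:M.
Proof.
apply/matrixP => i j; rewrite !mxE mcoeffU (inj_eq enum_val_inj).
by rewrite eq_sym.
Qed.

Lemma kmatrix_is_linear (X Y : finType) : linear (@kmatrix X Y).
Proof. by move=> c f g; apply/matrixP => i j; rewrite !mxE mcoeffD mcoeffZ. Qed.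

HB.instance Definition _ (X Y : finType) :=
  GRing.isLinear.Build k (kleisli X Y) 'M[k]_(#|Y|, #|X|) _ (@kmatrix X Y)
    (@kmatrix_is_linear X Y).

End Kleisli.
Arguments kid {k} X.
Arguments conv_unit {k} X.

Section Klcrep.
Variables (k : fieldType) (A : fdAlgebra k).

Record klcrep := Klcrep {
  klc_set : finType;
  klc_map : {linear A -> convAlg k klc_set};
  klc_map1 : klc_map aone = conv_unit klc_set;
  klc_mapM : forall a b, klc_map (amul a b) = conv (klc_map a) (klc_map b) }.

Definition klc_intertwines (M N : klcrep)
    (f : kleisli k (klc_set M) (klc_set N)) : Prop :=
  forall a : A, conv_matrix (klc_map N a) *m kmatrix f =
                kmatrix f *m conv_matrix (klc_map M a).

(* Boolean form of [klc_intertwines], which makes the morphisms a submodule   *)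
(* of the Kleisli arrows, the latter being added and scaled coefficientwise.  *)
Definition klc_hom_pred (M N : klcrep) :
    {pred kleisli k (klc_set M) (klc_set N)} :=
  fun f => `[< klc_intertwines f >].

Record klc_hom (M N : klcrep) := KlcHom {
  klc_arrow : kleisli k (klc_set M) (klc_set N);
  klc_arrowP : klc_arrow \in @klc_hom_pred M N }.

Fact klc_hom_submod_closed M N : submod_closed (@klc_hom_pred M N).
Proof.
split=> [|c f g /asboolP fP /asboolP gP]; apply/asboolP => a.
  by rewrite linear0 mulmx0 mul0mx.
by rewrite linearP mulmxDr mulmxDl -scalemxAr -scalemxAl fP gP.
Qed.

HB.instance Definition _ M N :=
  GRing.isSubmodClosed.Build k (kleisli k (klc_set M) (klc_set N))
    (@klc_hom_pred M N) (klc_hom_submod_closed M N).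
HB.instance Definition _ M N := [isSub for @klc_arrow M N].
HB.instance Definition _ M N := [Choice of klc_hom M N by <:].
HB.instance Definition _ M N := [SubChoice_isSubZmodule of klc_hom M N by <:].
HB.instance Definition _ M N := [SubZmodule_isSubLmodule of klc_hom M N by <:].

Fact klc_id_proof M : kid (klc_set M) \in @klc_hom_pred M M.
Proof. by apply/asboolP => a; rewrite kmatrix_id mulmx1 mul1mx. Qed.

Definition klc_id M : klc_hom M M := KlcHom (klc_id_proof M).

Fact klc_comp_proof M N P (g : klc_hom N P) (f : klc_hom M N) :
  kcomp (klc_arrow g) (klc_arrow f) \in @klc_hom_pred M P.
Proof.
have /asboolP gP := klc_arrowP g; have /asboolP fP := klc_arrowP f.
apply/asboolP => a.
by rewrite kmatrix_comp mulmxA gP -mulmxA fP mulmxA.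
Qed.

Definition klc_comp M N P (g : klc_hom N P) (f : klc_hom M N) : klc_hom M P :=
  KlcHom (klc_comp_proof g f).

Definition klcrepData : linCatData k := LinCatData klc_id klc_comp.

End Klcrep.

Section Rep.
Variables (k : fieldType) (A : fdAlgebra k).

Record repr := Repr {
  repr_space : vectType k;
  repr_map : {linear A -> 'End(repr_space)};
  repr_map1 : repr_map aone = \1%VF;
  repr_mapM : forall a b, repr_map (amul a b) = (repr_map a \o repr_map b)%VF }.

Definition repr_equivariant (V W : repr)
    (f : 'Hom(repr_space V, repr_space W)) : Prop :=
  forall (a : A) (v : repr_space V), f (repr_map V a v) = repr_map W a (f v).

Definition repr_hom_pred (V W : repr) :
    {pred 'Hom(repr_space V, repr_space W)} :=
  fun f => `[< repr_equivariant f >].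

Record repr_hom (V W : repr) := ReprHom {
  repr_lfun : 'Hom(repr_space V, repr_space W);
  repr_lfunP : repr_lfun \in @repr_hom_pred V W }.

Fact repr_hom_submod_closed V W : submod_closed (@repr_hom_pred V W).
Proof.
split=> [|c f g /asboolP fP /asboolP gP]; apply/asboolP => a v.
  by rewrite !zero_lfunE linear0.
by rewrite !add_lfunE !scale_lfunE fP gP linearP.
Qed.

HB.instance Definition _ V W :=
  GRing.isSubmodClosed.Build k 'Hom(repr_space V, repr_space W)
    (@repr_hom_pred V W) (repr_hom_submod_closed V W).
HB.instance Definition _ V W := [isSub for @repr_lfun V W].
HB.instance Definition _ V W := [Choice of repr_hom V W by <:].
HB.instance Definition _ V W := [SubChoice_isSubZmodule of repr_hom V W by <:].
HB.instance Definition _ V W := [SubZmodule_isSubLmodule of repr_hom V W by <:].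

Fact repr_id_proof V : \1%VF \in @repr_hom_pred V V.
Proof. by apply/asboolP => a v; rewrite !id_lfunE. Qed.

Definition repr_id V : repr_hom V V := ReprHom (repr_id_proof V).

Fact repr_comp_proof U V W (g : repr_hom V W) (f : repr_hom U V) :
  (repr_lfun g \o repr_lfun f)%VF \in @repr_hom_pred U W.
Proof.
have /asboolP gP := repr_lfunP g; have /asboolP fP := repr_lfunP f.
apply/asboolP => a v.
by rewrite !comp_lfunE fP gP.
Qed.

Definition repr_comp U V W (g : repr_hom V W) (f : repr_hom U V) :
    repr_hom U W :=
  ReprHom (repr_comp_proof g f).

Definition repData : linCatData k := LinCatData repr_id repr_comp.

Fact repData_isLinCat : isLinCat repData.
Proof.
split=> *; try (move=> c u v); apply: val_inj => /=.
- exact: comp_lfun1l.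
- exact: comp_lfun1r.
- exact: comp_lfunA.
- by rewrite comp_lfunDl comp_lfunZl.
- by rewrite comp_lfunDr comp_lfunZr.
Qed.

Definition rep : linCat k := LinCat repData_isLinCat.

End Rep.

(* Main.v *)
Require Import Defs.
From mathcomp Require Import all_boot all_order all_algebra.
From HB Require Import structures.
From mathcomp Require Import finmap.
From mathcomp.classical Require Import boolp functions.
From mathcomp.multinomials Require Import monalg.
(* Repeated so that [cid] denotes the identity arrow, not the choice operator. *)
Require Import Defs.

(** A convolution representation [(X, theta)] is a representation of [A] by
    matrices in disguise: [conv_matrix] carries [convAlg k X] isomorphically
    onto the algebra of [X * X] matrices, because the convolution product only
    keeps the pairs of basis elements [(i, j)], [(p, q)] with [j = p], which is
    the rule for multiplying matrix units. Likewise a Kleisli arrow [X ~> Y]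
    carries the same information as its matrix.

    So let [A] act on column vectors indexed by [X] through
    [conv_matrix (theta a)], and let a Kleisli arrow act through its matrix.
    This is a linear functor [cV_functor] into [rep A]. It is

    - faithful, since an arrow is determined by its matrix, and a matrix by its
      action on vectors ([cV_functor_faithful]);
    - full, since a linear map between spaces of columns is given by a matrix,
      every matrix comes from an arrow, and being equivariant is the same
      condition as intertwining the matrices ([cV_functor_full]);
    - essentially surjective: in a basis of the space of a representation, the
      action becomes a matrix representation, indexed by the finite set that
      numbers the basis, and the coordinate map is an equivariant isomorphism
      ([cV_functor_essentially_surjective]).

    A linear functor with these three properties is a linear equivalence
    ([fully_faithful_equivalence]). *)

Set Implicit Arguments.
Unset Strict Implicit.
Unset Printing Implicit Defensive.

Import GRing.Theory.
Local Open Scope ring_scope.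

(** * Fully faithful, essentially surjective linear functors *)

Section Criterion.
Variables (k : fieldType) (C D : linCat k) (F : linFunctor C D).

Definition full := forall (x y : C) (g : @chom k D (F x) (F y)),
  exists f : chom x y, fmap F f = g.

Definition faithful := forall x y : C, injective (@fmap k C D F x y).

Definition inverse_arrows (x y : D) (f : chom x y) (g : chom y x) :=
  ccomp g f = cid x /\ ccomp f g = cid y.

Definition essentially_surjective := forall d : D,
  exists (x : C) (e : @chom k D (F x) d) (e' : chom d (F x)),
    inverse_arrows e e'.

Lemma ccompDZl (E : linCat k) (x y z : E) (f : chom x y) c (g h : chom y z) :
  ccomp (c *: g + h) f = c *: ccomp g f + ccomp h f.
Proof. by have /(_ _ _ _ f c g h) := ccomp_linearl (lincatP E). Qed.

Lemma ccompDZr (E : linCat k) (x y z : E) (g : chom y z) c (f h : chom x y) :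
  ccomp g (c *: f + h) = c *: ccomp g f + ccomp g h.
Proof. by have /(_ _ _ _ g c f h) := ccomp_linearr (lincatP E). Qed.

(** The data chosen below are a section [pre] of each [fmap F] and, for each
    [d], a preimage [ob d] up to the isomorphism [e d]. *)
Section Inverse.
Variables (pre : forall x y : C, @chom k D (F x) (F y) -> chom x y).
Hypothesis fmap_pre : forall x y g, fmap F (@pre x y g) = g.
Hypothesis faithfulF : faithful.
Variables (ob : D -> C) (e : forall d, @chom k D (F (ob d)) d).
Variables (e' : forall d, chom d (F (ob d))).
Hypothesis eK : forall d, inverse_arrows (e d) (e' d).

Let c1f (x y : D) (f : chom x y) : ccomp (cid y) f = f.
Proof. exact: ccomp1f (lincatP D) _ _ f. Qed.
Let cf1 (x y : D) (f : chom x y) : ccomp f (cid x) = f.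
Proof. exact: ccompf1 (lincatP D) _ _ f. Qed.
Let cA (x y z t : D) (h : chom z t) (g : chom y z) (f : chom x y) :
  ccomp h (ccomp g f) = ccomp (ccomp h g) f.
Proof. exact: ccompA (lincatP D) _ _ _ _ h g f. Qed.

(** The preimage of [g] conjugated by the chosen isomorphisms. As [F] is
    faithful, every identity between such preimages, linearity included, may be
    checked after applying [F], where [pre] disappears. *)
Definition inv_map (d d' : D) (g : chom d d') : chom (ob d) (ob d') :=
  pre (ccomp (e' d') (ccomp g (e d))).

Lemma inv_map_is_linear d d' : linear (@inv_map d d').
Proof.
move=> c g h; apply: faithfulF.
by rewrite linearP !fmap_pre ccompDZl ccompDZr.
Qed.

HB.instance Definition _ d d' :=
  GRing.isLinear.Build k (chom d d') (chom (ob d) (ob d')) _ (@inv_map d d')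
    (@inv_map_is_linear d d').

Lemma inv_map1 d : inv_map (cid d) = cid (ob d).
Proof.
by apply: faithfulF; rewrite fmap_pre c1f (proj1 (eK d)) fmap1.
Qed.

Lemma inv_mapM (d1 d2 d3 : D) (g : chom d2 d3) (f : chom d1 d2) :
  inv_map (ccomp g f) = ccomp (inv_map g) (inv_map f).
Proof.
apply: faithfulF; rewrite fmapM !fmap_pre !cA; congr (ccomp (ccomp _ f) _).
by rewrite -[RHS]cA (proj2 (eK d2)) cf1.
Qed.

Definition inv_functor : linFunctor D C := @LinFunctor k D C ob
  (fun d d' => @inv_map d d') inv_map1 inv_mapM.

(** The unit at [x] is the preimage of the isomorphism [e' (F x)] from [F x] to
    [F (ob (F x))], and the counit is [e] itself. *)
Lemma inv_functor_equivalence : linearly_equivalent C D.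
Proof.
exists F, inv_functor; split.
  exists (fun x => pre (e' (F x))), (fun x => pre (e (F x))).
  split=> [x|x|x y f]; apply: faithfulF; rewrite !fmapM !fmap_pre ?fmap1.
  - exact: (proj2 (eK _)).
  - exact: (proj1 (eK _)).
  - by rewrite -!cA (proj2 (eK _)) cf1.
exists e, e'; split=> [d|d|d d' f].
- exact: (proj1 (eK _)).
- exact: (proj2 (eK _)).
- by rewrite /= fmap_pre cA (proj2 (eK _)) c1f.
Qed.

End Inverse.

(** The hypotheses only assert existence; the preimages and isomorphisms that
    define the inverse functor are obtained by the axiom of choice. *)
Theorem fully_faithful_equivalence :
  full -> faithful -> essentially_surjective -> linearly_equivalent C D.
Proof.
move=> fullF faithfulF esF.
apply: (@inv_functor_equivalence (fun x y g => sval (boolp.cid (fullF x y g)))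
  (fun x y g => svalP (boolp.cid (fullF x y g))) faithfulF
  (fun d => sval (boolp.cid (esF d)))
  (fun d => sval (boolp.cid (svalP (boolp.cid (esF d)))))
  (fun d => sval (boolp.cid (svalP (boolp.cid (svalP (boolp.cid (esF d))))))))
  => d.
exact: (svalP (boolp.cid (svalP (boolp.cid (svalP (boolp.cid (esF d))))))).
Qed.

End Criterion.

(** * Kleisli arrows as matrices *)

Section KleisliMatrix.
Variable k : fieldType.

Lemma kmatrix_inj (X Y : finType) : injective (@kmatrix k X Y).
Proof.
move=> f g efg; apply/funext => x; apply/malgP => y.
have /matrixP/(_ (enum_rank y) (enum_rank x)) := efg.
by rewrite !mxE !enum_rankK.
Qed.

(** For a finite middle set, the sum over the support in a Kleisli composite can
    be extended to the whole set; the extra terms vanish. *)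
Lemma kcomp_coeffE (X Z : choiceType) (Y : finType) (h : kleisli k Y Z)
    (f : kleisli k X Y) x z :
  (kcomp h f x)@_z = \sum_(y : Y) (f x)@_y * (h y)@_z.
Proof.
rewrite /kcomp freemod_bindE big_uniq ?fset_uniq //= big_mkcond /=.
by apply: eq_bigr => y _; case: ifPn => // /mcoeff_outdom ->; rewrite mul0r.
Qed.

Lemma kleisli_coeffP (X Y : choiceType) c (f g : kleisli k X Y) x y :
  ((c *: f + g) x)@_y = c * (f x)@_y + (g x)@_y.
Proof. by apply: etrans (mcoeffD _ _ _) _; rewrite mcoeffZ. Qed.

Lemma kcomp_linearl (X Z : choiceType) (Y : finType) (f : kleisli k X Y) :
  linear (fun h : kleisli k Y Z => kcomp h f).
Proof.
move=> c h h'; apply/funext => x; apply/malgP => z.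
rewrite kcomp_coeffE [RHS]kleisli_coeffP.
under eq_bigr => y _ do rewrite kleisli_coeffP mulrDr mulrCA.
rewrite big_split -mulr_sumr /=.
by congr (c * _ + _); apply/esym/kcomp_coeffE.
Qed.

Lemma kcomp_linearr (X Z : choiceType) (Y : finType) (h : kleisli k Y Z) :
  linear (fun f : kleisli k X Y => kcomp h f).
Proof.
move=> c f f'; apply/funext => x; apply/malgP => z.
rewrite kcomp_coeffE [RHS]kleisli_coeffP.
under eq_bigr => y _ do rewrite kleisli_coeffP mulrDl -mulrA.
rewrite big_split -mulr_sumr /=.
by congr (c * _ + _); apply/esym/kcomp_coeffE.
Qed.

Lemma mcoeff_sum_basis (X : finType) (c : X -> k) x :
  (\sum_(y : X) << c y *g y >> : {malg k[X]})@_x = c x.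
Proof.
rewrite raddf_sum /= (bigD1 x) //= mcoeffUU big1 ?addr0 // => y /negPf yx.
by rewrite mcoeffU yx.
Qed.

Definition kmatrix_inv (X Y : finType) (M : 'M[k]_(#|Y|, #|X|)) :
    kleisli k X Y :=
  fun x => \sum_(y : Y) << M (enum_rank y) (enum_rank x) *g y >>.

Lemma kmatrix_invK (X Y : finType) : cancel (@kmatrix_inv X Y) (@kmatrix k X Y).
Proof.
by move=> M; apply/matrixP => i j; rewrite mxE mcoeff_sum_basis !enum_valK.
Qed.

Lemma conv_matrix_is_linear (X : finType) : linear (@conv_matrix k X).
Proof. by move=> c f g; apply/matrixP => i j; rewrite !mxE mcoeffD mcoeffZ. Qed.

HB.instance Definition _ (X : finType) :=
  GRing.isLinear.Build k (convAlg k X) 'M[k]_#|X| _ (@conv_matrix k X)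
    (@conv_matrix_is_linear X).

Definition conv_matrix_inv (X : finType) (M : 'M[k]_#|X|) : convAlg k X :=
  fun=> \sum_(p : X * X) << M (enum_rank p.1) (enum_rank p.2) *g p >>.

Lemma conv_matrixK (X : finType) :
  cancel (@conv_matrix k X) (@conv_matrix_inv X).
Proof.
move=> f; apply/funext => -[]; apply/malgP => -[x y].
by rewrite mcoeff_sum_basis mxE !enum_rankK.
Qed.

Lemma conv_matrix_invK (X : finType) :
  cancel (@conv_matrix_inv X) (@conv_matrix k X).
Proof.
by move=> M; apply/matrixP => i j; rewrite mxE mcoeff_sum_basis !enum_valK.
Qed.

Lemma conv_matrix_inj (X : finType) : injective (@conv_matrix k X).
Proof. exact: can_inj (@conv_matrixK X). Qed.

HB.instance Definition _ (X : finType) :=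
  GRing.isLinear.Build k 'M[k]_#|X| (convAlg k X) _ (@conv_matrix_inv X)
    (can2_linear (@conv_matrixK X) (@conv_matrix_invK X)).

Lemma conv_matrix1 (X : finType) :
  conv_matrix (conv_unit X) = 1%:M :> 'M[k]_#|X|.
Proof.
apply/matrixP => i j; rewrite !mxE raddf_sum /= (bigD1 (enum_val i)) //=.
rewrite mcoeffU xpair_eqE eqxx (inj_eq enum_val_inj).
rewrite big1 ?addr0 // => y /negPf yi.
by rewrite mcoeffU xpair_eqE yi.
Qed.

Lemma ktensor_coeffE (X X' : choiceType) (Y Y' : finType)
    (f : kleisli k X Y) (g : kleisli k X' Y') p y y' :
  (ktensor f g p)@_(y, y') = (f p.1)@_y * (g p.2)@_y'.
Proof.
rewrite /ktensor raddf_sum /= big_uniq ?fset_uniq //= big_mkcond (bigD1 y) //=.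
rewrite [X in _ + X]big1 ?addr0 => [|z /negPf zy].
  case: ifPn => [_|/mcoeff_outdom ->]; last by rewrite mul0r.
  rewrite raddf_sum /= big_uniq ?fset_uniq //= big_mkcond (bigD1 y') //=.
  rewrite [X in _ + X]big1 ?addr0 => [|z' /negPf zy'].
    by case: ifPn => [_|/mcoeff_outdom ->]; rewrite ?mulr0 // mcoeffUU.
  by case: ifP => // _; rewrite mcoeffU xpair_eqE zy' andbF.
case: ifP => // _; rewrite raddf_sum big1 //= => z' _.
by rewrite mcoeffU xpair_eqE zy.
Qed.

(** Convolution sums over all quadruples [((a, b), (c, d))] of indices the
    product of the coefficients at [(a, b)] and [(c, d)]. The pairing kills the
    quadruple unless [b = c] and sends it to [(a, d)] otherwise, so only
    [a = i] and [d = j] contribute to the coefficient at [(i, j)], and the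
    remaining sum over [b] is the entry of the matrix product. *)
Lemma conv_matrixM (X : finType) (f g : convAlg k X) :
  conv_matrix (conv f g) = conv_matrix f *m conv_matrix g.
Proof.
apply/matrixP => i j; rewrite !mxE /conv kcomp_coeffE.
transitivity (\sum_(p : (X * X) * (X * X))
  (f tt)@_p.1 * (g tt)@_p.2 * (@conv_pairing k X p)@_(enum_val i, enum_val j)).
  apply: eq_bigr => -[p q] _; congr (_ * _).
  rewrite kcomp_coeffE (big_pred1 (tt, tt)) => [|[[] []] //].
  by rewrite /kpure mcoeffUU mul1r ktensor_coeffE.
transitivity (\sum_(a : X) \sum_(b : X) \sum_(q : X * X)
  (f tt)@_(a, b) * (g tt)@_q *
  (@conv_pairing k X ((a, b), q))@_(enum_val i, enum_val j)).
  by rewrite !pair_bigA /=; apply: eq_bigr => -[[a b] q] _.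
(* Only [a = i] survives; the sum over [b] is then the one of [mxE], once
   [b] is numbered by [enum_val]. *)
rewrite (bigD1 (enum_val i)) //= [X in _ + X]big1 ?addr0; last first.
  move=> a /negPf ai; apply: big1 => b _; apply: big1 => -[c d] _.
  rewrite /conv_pairing /=; case: eqP => _; last by rewrite mcoeff0 mulr0.
  by rewrite mcoeffU xpair_eqE ai mulr0.
rewrite (reindex (enum_val (A := X))) /=; last exact/onW_bij/enum_val_bij.
apply: eq_bigr => l _; rewrite !mxE.
(* With [b = l] fixed, only the pair [(c, d) = (l, j)] survives. *)
rewrite (bigD1 (enum_val l, enum_val j)) //= [X in _ + X]big1 ?addr0.
  by rewrite /conv_pairing /= eqxx mcoeffUU mulr1.
move=> [c d]; rewrite xpair_eqE eq_sym /conv_pairing /=.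
case: ifP => /= [_ /negPf dj | _ _]; last by rewrite mcoeff0 mulr0.
by rewrite mcoeffU xpair_eqE dj andbF mulr0.
Qed.

End KleisliMatrix.

(** * The category of convolution representations *)

Section Equivalence.
Variables (k : fieldType) (A : fdAlgebra k).

Lemma klcrep_isLinCat : isLinCat (klcrepData A).
Proof.
split=> *; try (move=> c u v); apply: val_inj => /=.
- by apply: kmatrix_inj; rewrite kmatrix_comp kmatrix_id mul1mx.
- by apply: kmatrix_inj; rewrite kmatrix_comp kmatrix_id mulmx1.
- by apply: kmatrix_inj; rewrite !kmatrix_comp mulmxA.
- exact: kcomp_linearl.
- exact: kcomp_linearr.
Qed.

Definition klcat : linCat k := LinCat klcrep_isLinCat.

(** * The action on column vectors *)

Definition mxfun m n (M : 'M[k]_(m, n)) : 'Hom('cV[k]_n, 'cV[k]_m) :=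
  linfun (mulmx M).

Lemma mxfunE m n (M : 'M[k]_(m, n)) v : mxfun M v = M *m v.
Proof. by rewrite lfunE. Qed.

Lemma mxfun_is_linear m n : linear (@mxfun m n).
Proof.
move=> c M N; apply/lfunP => v.
by rewrite add_lfunE scale_lfunE !mxfunE mulmxDl -scalemxAl.
Qed.

HB.instance Definition _ m n :=
  GRing.isLinear.Build k 'M[k]_(m, n) 'Hom('cV[k]_n, 'cV[k]_m) _ (@mxfun m n)
    (@mxfun_is_linear m n).

Lemma mulmx_cV_inj m n (M N : 'M[k]_(m, n)) :
  (forall v : 'cV[k]_n, M *m v = N *m v) -> M = N.
Proof.
move=> eMN; apply/matrixP => i j.
by have /matrixP/(_ i 0) := eMN (delta_mx j 0); rewrite -!colE !mxE.
Qed.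

Lemma mxfun_inj m n : injective (@mxfun m n).
Proof. by move=> M N eMN; apply: mulmx_cV_inj => v; rewrite -!mxfunE eMN. Qed.

Definition funmx m n (f : 'cV[k]_n -> 'cV[k]_m) : 'M[k]_(m, n) :=
  \matrix_(i, j) f (delta_mx j 0) i 0.

Lemma funmxE m n (f : {linear 'cV[k]_n -> 'cV[k]_m}) v : funmx f *m v = f v.
Proof.
rewrite [v in RHS]matrix_sum_delta linear_sum /=; apply/matrixP => i j.
rewrite !mxE summxE; apply: eq_bigr => l _.
by rewrite big_ord1 linearZ !mxE !ord1 mulrC.
Qed.

Section Object.
Variable M : klcrep A.

Definition cV_map : A -> 'End('cV[k]_#|klc_set M|) :=
  @mxfun _ _ \o @conv_matrix k (klc_set M) \o klc_map M.

HB.instance Definition _ := GRing.Linear.on cV_map.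

Lemma cV_map1 : cV_map aone = \1%VF.
Proof.
apply/lfunP => v.
by rewrite /cV_map /= klc_map1 conv_matrix1 mxfunE mul1mx id_lfunE.
Qed.

Lemma cV_mapM a b : cV_map (amul a b) = (cV_map a \o cV_map b)%VF.
Proof.
apply/lfunP => v.
by rewrite comp_lfunE /cV_map /= klc_mapM conv_matrixM !mxfunE mulmxA.
Qed.

Definition cV_repr : repr A := Repr cV_map1 cV_mapM.

End Object.

(** Equivariance is the intertwining relation evaluated at each vector; columns
    separate matrices, hence the equivalence. It gives both the action of the
    functor on arrows and its fullness. *)
Lemma repr_hom_mxfun (M N : klcrep A) (f : kleisli k (klc_set M) (klc_set N)) :
  (mxfun (kmatrix f) \in @repr_hom_pred k A (cV_repr M) (cV_repr N)) =
  (f \in @klc_hom_pred k A M N).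
Proof.
apply/asboolP/asboolP => [eq_f a | int_f a v].
  apply: mulmx_cV_inj => v; have := eq_f a v.
  by rewrite /= /cV_map /= !mxfunE !mulmxA.
by rewrite /= /cV_map /= !mxfunE !mulmxA int_f.
Qed.

Definition cV_hom (M N : klcrep A) (f : klc_hom M N) :
    repr_hom (cV_repr M) (cV_repr N) :=
  ReprHom (etrans (repr_hom_mxfun (klc_arrow f)) (klc_arrowP f)).

Lemma cV_hom_is_linear M N : linear (@cV_hom M N).
Proof.
move=> c f g; apply: val_inj.
exact: etrans (congr1 (@mxfun _ _) (kmatrix_is_linear c _ _))
  (mxfun_is_linear _ _ _).
Qed.

HB.instance Definition _ M N :=
  GRing.isLinear.Build k (klc_hom M N) (repr_hom (cV_repr M) (cV_repr N)) _
    (@cV_hom M N) (@cV_hom_is_linear M N).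

Lemma cV_hom1 (M : klcrep A) : cV_hom (klc_id M) = repr_id (cV_repr M).
Proof.
apply: val_inj; apply/lfunP => v.
by rewrite /= mxfunE kmatrix_id mul1mx id_lfunE.
Qed.

Lemma cV_homM (M N P : klcrep A) (g : klc_hom N P) (f : klc_hom M N) :
  cV_hom (klc_comp g f) = repr_comp (cV_hom g) (cV_hom f).
Proof.
apply: val_inj; apply/lfunP => v.
by rewrite /= comp_lfunE !mxfunE kmatrix_comp mulmxA.
Qed.

Definition cV_functor : linFunctor klcat (rep A) :=
  @LinFunctor k klcat (rep A) cV_repr (fun M N => @cV_hom M N) cV_hom1 cV_homM.

Lemma cV_functor_faithful : faithful cV_functor.
Proof.
by move=> M N f g /(congr1 val) /= /mxfun_inj/kmatrix_inj efg; apply: val_inj.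
Qed.

Lemma cV_functor_full : full cV_functor.
Proof.
move=> M N [g gP]; pose f := kmatrix_inv (funmx g).
have fg : mxfun (kmatrix f) = g.
  by apply/lfunP => v; rewrite mxfunE kmatrix_invK funmxE.
have fP : f \in @klc_hom_pred k A M N by rewrite -repr_hom_mxfun fg.
by exists (KlcHom fP); apply: val_inj.
Qed.

(** * Coordinates on a finite-dimensional space *)

Section Coordinates.
Variable V : vectType k.

(** The finite set that carries the convolution representation attached to [V].
    It numbers a basis of [V]; [coords] uses [enum_val] since columns are indexed
    by the enumeration of this set. *)
Definition coord_set : finType := 'I_(\dim {:V}).

Definition coords (v : V) : 'cV[k]_#|coord_set| :=
  \col_i coord (vbasis {:V}) (enum_val i) v.

Definition of_coords (c : 'cV[k]_#|coord_set|) : V :=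
  \sum_(i < \dim {:V}) c (enum_rank i) 0 *: (vbasis {:V})`_i.

Lemma coordsK : cancel coords of_coords.
Proof.
move=> v; rewrite [RHS](coord_vbasis (memvf v)).
by apply: eq_bigr => i _; rewrite mxE enum_rankK.
Qed.

Lemma of_coordsK : cancel of_coords coords.
Proof.
move=> c; apply/colP => i; rewrite mxE coord_sum_free ?enum_valK //.
exact/basis_free/vbasisP.
Qed.

Lemma coords_is_linear : linear coords.
Proof. by move=> c u v; apply/colP => i; rewrite !(linearP, mxE). Qed.

HB.instance Definition _ :=
  GRing.isLinear.Build k V 'cV[k]_#|coord_set| _ coords coords_is_linear.

HB.instance Definition _ :=
  GRing.isLinear.Build k 'cV[k]_#|coord_set| V _ of_coords
    (can2_linear coordsK of_coordsK).

Definition endmx (f : 'End(V)) : 'M[k]_#|coord_set| :=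
  funmx (coords \o f \o of_coords).

Lemma endmxE f v : endmx f *m v = coords (f (of_coords v)).
Proof. exact: funmxE. Qed.

Lemma endmx_is_linear : linear endmx.
Proof.
move=> c f g; apply: mulmx_cV_inj => v; rewrite mulmxDl -scalemxAl !endmxE.
by rewrite add_lfunE scale_lfunE linearP.
Qed.

HB.instance Definition _ :=
  GRing.isLinear.Build k 'End(V) 'M[k]_#|coord_set| _ endmx endmx_is_linear.

End Coordinates.

(** * The convolution representation in a basis *)

Section EssentialSurjectivity.
Variable V : repr A.
Let X := coord_set (repr_space V).

Definition coord_map : A -> convAlg k X :=
  @conv_matrix_inv k X \o @endmx (repr_space V) \o repr_map V.

HB.instance Definition _ := GRing.Linear.on coord_map.

Lemma coord_map_matrix a : conv_matrix (coord_map a) = endmx (repr_map V a).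
Proof. exact: conv_matrix_invK. Qed.

Lemma coord_map1 : coord_map aone = conv_unit X.
Proof.
apply: conv_matrix_inj; rewrite coord_map_matrix conv_matrix1.
apply: mulmx_cV_inj => v.
by rewrite endmxE repr_map1 id_lfunE of_coordsK mul1mx.
Qed.

Lemma coord_mapM a b : coord_map (amul a b) = conv (coord_map a) (coord_map b).
Proof.
apply: conv_matrix_inj; apply: etrans (esym (conv_matrixM _ _)).
apply: etrans (coord_map_matrix _) _.
apply: etrans (esym (congr2 mulmx (coord_map_matrix a) (coord_map_matrix b))).
apply: mulmx_cV_inj => v.
by rewrite -mulmxA !endmxE repr_mapM comp_lfunE coordsK.
Qed.

Definition coord_klcrep : klcrep A := Klcrep coord_map1 coord_mapM.

(** The matrix of [repr_map V a] is by construction its conjugate by [coords],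
    so the two inverse coordinate maps commute with the actions. *)
Lemma of_coords_equivariant :
  linfun (@of_coords (repr_space V)) \in
    @repr_hom_pred k A (cV_repr coord_klcrep) V.
Proof.
apply/asboolP => a v; rewrite !lfunE /= /cV_map /= coord_map_matrix.
by rewrite endmxE coordsK.
Qed.

Lemma coords_equivariant :
  linfun (@coords (repr_space V)) \in
    @repr_hom_pred k A V (cV_repr coord_klcrep).
Proof.
apply/asboolP => a v; rewrite !lfunE /= /cV_map /= coord_map_matrix.
by rewrite endmxE coordsK.
Qed.

End EssentialSurjectivity.

Lemma cV_functor_essentially_surjective : essentially_surjective cV_functor.
Proof.
move=> V; exists (coord_klcrep V).
exists (ReprHom (of_coords_equivariant V)), (ReprHom (coords_equivariant V)).
split; apply: val_inj; apply/lfunP => v; rewrite /= comp_lfunE !lfunE /=.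
- exact: of_coordsK.
- exact: coordsK.
Qed.

End Equivalence.

Theorem theorem3 (k : fieldType) (A : fdAlgebra k) :
  exists klcrepP : isLinCat (klcrepData A),
    linearly_equivalent (LinCat klcrepP) (rep A).
Proof.
exists (@klcrep_isLinCat k A).
apply: (@fully_faithful_equivalence k (klcat A) (rep A) (cV_functor A)).
- exact: cV_functor_full.
- exact: cV_functor_faithful.
- exact: cV_functor_essentially_surjective.
Qed.
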